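(* Let $\alpha$ be an algebraic integer of degree $k$ over $\mathbf{Q}$ and let $f(x)$ be its minimal polynomial over $\mathbf{Q}$. Let $m>2$ be an integer such that (i) the $m$-th cyclotomic field $\mathbf{Q}(\zeta)$, where $\zeta=\exp(2\pi i/m)$, and $\mathbf{Q}(\alpha)$ are linearly disjoint over $\mathbf{Q}$, and (ii) the degree of $\alpha^m$ over $\mathbf{Q}$ equals the degree of $\alpha$ over $\mathbf{Q}$. Let $f_m(x)$ be the minimal polynomial of $\alpha^m$ over $\mathbf{Q}$ and define $F_m(x):=f_m(x^m)$. Then $F_m(x)$ factors in $\mathbf{Q}[x]$ into irreducible factors with exactly one irreducible factor, denoted $\Phi_{d,f}(x)$, for each positive divisor $d$ of $m$, of degree $\deg(f)\cdot\varphi(d)=k\varphi(d)$; that is, \[F_m(x)=f_m(x^m)=\prod_{d\mid m}\Phi_{d,f}(x),\qquad \deg(\Phi_{d,f})=\deg(f)\cdot\varphi(d),\] with each $\Phi_{d,f}(x)$ irreducible in $\mathbf{Q}[x]$.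
   Context: $\varphi$ denotes Euler's totient function. The factors $\Phi_{d,f}(x)$ are called relative $d$-th cyclotomic polynomials relative to $f$.
   Formalization: The formal statement assumes in addition that α ≠ 0; for α = 0 all hypotheses hold but F_m(x) = x^m has only the irreducible factor x, so no factor of degree φ(m) > 1 exists. *)

(* Defs.v *)
From mathcomp Require Export all_boot all_order all_algebra all_field.

Set Implicit Arguments.
Unset Strict Implicit.
Unset Printing Implicit Defensive.

Import GRing.Theory Num.Theory.
Local Open Scope ring_scope.

(* [m.-root (-1)] is the m-th root of -1 with least nonnegative argument, i.e. *)
(* exp(pi i / m) for m > 1; its square is exp(2 pi i / m).                     *)
Definition zeta (m : nat) : algC := (m.-root (-1)) ^+ 2.

Definition degQ (x : algC) : nat := (size (minCpoly x)).-1.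

(* [minCpoly x] has rational coefficients but lives in {poly algC}; this says  *)
(* that [p] is the same polynomial viewed in Q[x].                             *)
Definition is_minQpoly (p : {poly rat}) (x : algC) : Prop :=
  map_poly ratr p = minCpoly x.

(* The subfield Q(x) of algC. *)
Definition Qadjoin (x : algC) (y : algC) : Prop :=
  exists p q : {poly rat},
    (map_poly ratr q).[x] != 0 /\ y = (map_poly ratr p).[x] / (map_poly ratr q).[x].

Definition lin_indep_over (F : algC -> Prop) (n : nat) (v : 'I_n -> algC) : Prop :=
  forall c : 'I_n -> algC,
    (forall i, F (c i)) -> \sum_(i < n) c i * v i = 0 -> forall i, c i = 0.

(* Linear disjointness of subfields K and L over a common subfield F: finite   *)
(* families in K that are free over F remain free over L.                      *)
Definition lin_disjoint (F K L : algC -> Prop) : Prop :=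
  forall (n : nat) (v : 'I_n -> algC),
    (forall i, K (v i)) -> lin_indep_over F v -> lin_indep_over L v.

Definition lin_disjoint_overQ (K L : algC -> Prop) : Prop :=
  lin_disjoint (fun x => x \in Crat) K L.

(* Main.v *)
Require Import Defs.
From mathcomp Require Import all_boot all_order all_algebra all_field.
From mathcomp Require Import ring.

(** Write z_d := zeta^(m/d), a primitive d-th root of unity, and take for Phi_d
    the minimal polynomial over Q of alpha z_d.  Since alpha^m has the same
    degree as alpha, alpha = g(alpha^m) for some g in Q[x], so x |-> x^m is
    injective on the conjugates of alpha.  By linear disjointness a rational
    polynomial vanishing at alpha z_d vanishes at every x * eta with x conjugate
    to alpha and eta a primitive d-th root of unity; these k phi(d) numbers are
    distinct, so deg Phi_d >= k phi(d).  The Phi_d are pairwise coprime divisors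
    of f_m(x^m), whose degree is k m = sum_(d | m) k phi(d); hence all the
    inequalities are equalities and f_m(x^m) is the product of the Phi_d. *)

Set Implicit Arguments.
Unset Strict Implicit.
Unset Printing Implicit Defensive.

Import Order.TTheory GRing.Theory Num.Theory.
Local Open Scope ring_scope.

(** * The root [zeta m] is primitive *)

(** The last two inequalities place [t] within half the angle of [u] from 1, while ['Re t <= 'Re u]
    places it at least the whole angle away. *)
Lemma Re_mul_div_unit (C : numClosedFieldType) (t u : C) :
    `|t| = 1 -> `|u| = 1 -> u != 1 -> 'Re t <= 'Re u ->
  'Re (t * u) <= 'Re t -> 'Re (t / u) <= 'Re t -> False.
Proof.
move=> t1 u1 u_neq1; rewrite Re_div ReM u1 expr1n divr1.
have := normC2_Re_Im t; have := normC2_Re_Im u; rewrite t1 u1 expr1n.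
have : 'Re u < 1.
  rewrite lt_neqAle -{2}u1 leif_Re_Creal andbT -{1}u1 leif_Re_Creal.
  by apply: contraNN u_neq1 => u_ge0; rewrite -u1 ger0_norm.
move: ('Re u) ('Im u) ('Re t) ('Im t) => a b c d a_lt1 ab cd le_ca.
rewrite -subr_ge0 => p_ge0; rewrite -subr_ge0 => q_ge0.
have a1 : 0 < 1 - a by rewrite subr_gt0.
(* The sum of the two inequalities gives [0 <= c], and their product gives [1 + a <= 2 c^2]. Since
   [c^2 <= a^2 <= a], this contradicts [a < 1]. *)
have c_ge0 : 0 <= c.
  have := addr_ge0 p_ge0 q_ge0.
  have -> : c - (c * a - d * b) + (c - (c * a + d * b)) = (1 - a) * (c *+ 2) by ring.
  by rewrite pmulr_rge0 // pmulrn_lge0.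
have := mulr_ge0 p_ge0 q_ge0.
have -> : (c - (c * a - d * b)) * (c - (c * a + d * b)) =
          (1 - a) * (c ^+ 2 *+ 2 - (1 + a)).
  have -> : (c - (c * a - d * b)) * (c - (c * a + d * b)) =
     c ^+ 2 * (1 - a) ^+ 2 - d ^+ 2 * b ^+ 2 by ring.
  have -> : d ^+ 2 = 1 - c ^+ 2 by rewrite cd addrAC subrr add0r.
  have -> : b ^+ 2 = 1 - a ^+ 2 by rewrite ab addrAC subrr add0r.
  by ring.
rewrite pmulr_rge0 // subr_ge0 => le_c2.
have a_ge0 := le_trans c_ge0 le_ca.
have le_c2a : c ^+ 2 <= a.
  apply: le_trans (_ : a ^+ 2 <= a); first by rewrite lerXn2r ?nnegrE.
  by rewrite expr2 ler_piMl // ltW.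
have : 1 + a <= a + a by apply: le_trans le_c2 _; rewrite mulr2n lerD.
by rewrite lerD2r => /(lt_le_trans a_lt1); rewrite ltxx.
Qed.

Lemma norm_unity_root (C : numClosedFieldType) (n : nat) (x : C) :
  (0 < n)%N -> x ^+ n = 1 -> `|x| = 1.
Proof.
move=> n_gt0 xn1; apply/eqP; rewrite -(@pexpr_eq1 _ _ n) //.
by rewrite -normrX xn1 normr1.
Qed.

(* Let [z] be a generator and [t] the element of largest real part in the coset
   [z * <u>].  If [t != 1] then one of [t * u] and [t / u] has a larger real
   part than [t]; hence [z^-1] is a power of [u]. *)
Lemma max_Re_prim_root (n : nat) (u : algC) :
    u ^+ n = 1 -> u != 1 ->
    (forall x : algC, x ^+ n = 1 -> x != 1 -> 'Re x <= 'Re u) ->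
  (0 < n)%N -> n.-primitive_root u.
Proof.
move=> un1 u_neq1 u_max n_gt0.
have [z prim_z] := C_prim_root_exists n_gt0.
have zn1 := prim_expr_order prim_z.
pose F (i : 'I_n) := 'Re (z * u ^+ i).
pose i0 := Ordinal n_gt0.
have [i _ i_max] := @real_arg_maxP _ _ i0 xpredT F isT (fun _ _ => Creal_Re _).
pose t := z * u ^+ i.
have tn1 : t ^+ n = 1 by rewrite exprMn zn1 mul1r exprAC un1 expr1n.
have t_max (k : nat) : 'Re (z * u ^+ k) <= 'Re t.
  by have := i_max (Ordinal (ltn_pmod k n_gt0)) isT; rewrite /F /= expr_mod.
have u_norm := norm_unity_root n_gt0 un1.
have u_neq0 : u != 0 by rewrite -normr_eq0 u_norm oner_eq0.
have t1 : t = 1.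
  apply/eqP/negPn/negP => t_neq1.
  apply: (@Re_mul_div_unit _ t u) => //; first exact: norm_unity_root n_gt0 tn1.
  - exact: u_max.
  - by rewrite -mulrA -exprSr.
  have -> : u^-1 = u ^+ n.-1.
    by apply: (mulfI u_neq0); rewrite -exprS prednK // un1 divff.
  by rewrite -mulrA -exprD.
have [k prim_u dv_kn] := prim_order_exists n_gt0 un1.
suff /eqP <- : k == n by [].
rewrite eqn_dvd dv_kn (prim_order_dvd prim_z) /=.
have := congr1 (fun x => x ^+ k) t1.
by rewrite /t exprMn exprAC (prim_expr_order prim_u) !expr1n mulr1 => ->.
Qed.

(** A nontrivial 2m-th root of unity [u] of largest real part is primitive, so [u ^+ m = -1]. The
    chosen root [w] has the largest real part among the m-th roots of -1 in the closed upper half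
    plane, so it is maximal too. *)
Lemma rootCN1_prim_root (m : nat) :
  (1 < m)%N -> (m.*2).-primitive_root (m.-root (-1) : algC).
Proof.
move=> m_gt1; have m_gt0 := ltnW m_gt1; set w := m.-root _.
have wm : w ^+ m = -1 by rewrite rootCK.
have n_gt0 : (0 < m.*2)%N by rewrite double_gt0.
have n_gt1 : (1 < m.*2)%N by rewrite -addnn (leq_trans m_gt1) ?leq_addr.
have [z prim_z] := C_prim_root_exists n_gt0.
have zn1 := prim_expr_order prim_z.
pose P (i : 'I_m.*2) := z ^+ i != 1.
have P1 : P (Ordinal n_gt1).
  rewrite /P /= -(prim_order_dvd prim_z) dvdn1.
  by rewrite gtn_eqF.
have [i Pi i_max] := @real_arg_maxP _ _ _ P (fun i => 'Re (z ^+ i)) P1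
  (fun _ _ => Creal_Re _).
set u := z ^+ i in i_max Pi.
have un1 : u ^+ m.*2 = 1 by rewrite exprAC zn1 expr1n.
have u_max x : x ^+ m.*2 = 1 -> x != 1 -> 'Re x <= 'Re u.
  by move=> /(prim_rootP prim_z)[j ->] /i_max.
have prim_u : (m.*2).-primitive_root u by exact: max_Re_prim_root.
have um : u ^+ m = -1.
  have : (u ^+ m) ^+ 2 == 1 by rewrite -exprM muln2 un1.
  rewrite sqrf_eq1 => /orP[|/eqP //]; rewrite -(prim_order_dvd prim_u).
  by move/(dvdn_leq m_gt0); rewrite -addnn leqNgt -{1}(addn0 m) ltn_add2l m_gt0.
have wn1 : w ^+ m.*2 = 1 by rewrite -muln2 exprM wm sqrrN expr1n.
have w_neq1 : w != 1.
  apply: contra_eq_neq wm => ->; rewrite expr1n eq_sym.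
  by rewrite -subr_eq0 -opprD oppr_eq0 (pnatr_eq0 _ 2).
have le_uw : 'Re u <= 'Re w.
  (* If [u] lies below the real axis, its conjugate has the same real part and is again an m-th root
     of -1. *)
  have [Im_u | Im_u] := real_ge0P (Creal_Im u); first exact: rootC_Re_max.
  rewrite -Re_conj; apply: rootC_Re_max => //; last by rewrite Im_conj oppr_ge0 ltW.
  by rewrite -rmorphXn um rmorphN1.
apply: max_Re_prim_root => // x xn1 x_neq1.
by apply: le_trans le_uw; apply: u_max.
Qed.

Lemma zeta_prim_root (m : nat) : (1 < m)%N -> m.-primitive_root (zeta m).
Proof.
move=> m_gt1; have m_dv : (m %| m.*2)%N by rewrite -muln2 dvdn_mulr.
have := dvdn_prim_root (rootCN1_prim_root m_gt1) m_dv.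
by rewrite -[X in (X %/ _)%N]muln2 mulKn // ltnW.
Qed.

(** * Minimal polynomials over the rationals *)

Local Notation pQtoC := (map_poly (ratr : rat -> algC)).

Definition minQpoly (x : algC) : {poly rat} := s2val (minCpolyP x).

Lemma map_minQpoly (x : algC) : pQtoC (minQpoly x) = minCpoly x.
Proof. by rewrite /minQpoly; case: (minCpolyP x) => p /= []. Qed.

Lemma minQpoly_monic (x : algC) : minQpoly x \is monic.
Proof. by rewrite /minQpoly; case: (minCpolyP x) => p /= []. Qed.

Lemma minQpoly_neq0 (x : algC) : minQpoly x != 0.
Proof. exact/monic_neq0/minQpoly_monic. Qed.

Lemma root_minQpoly_dvd (x : algC) (q : {poly rat}) :
  root (pQtoC q) x = (minQpoly x %| q).
Proof. by rewrite /minQpoly; case: (minCpolyP x). Qed.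

Lemma root_minQpoly (x : algC) : root (pQtoC (minQpoly x)) x.
Proof. by rewrite root_minQpoly_dvd. Qed.

Lemma is_minQpolyE (p : {poly rat}) (x : algC) : is_minQpoly p x -> p = minQpoly x.
Proof. by rewrite /is_minQpoly -map_minQpoly => /map_poly_inj. Qed.

Lemma size_minQpoly (x : algC) : size (minQpoly x) = (degQ x).+1.
Proof.
rewrite /degQ prednK; last exact: ltn_trans (size_minCpoly x).
by rewrite -map_minQpoly size_map_poly.
Qed.

Lemma degQ_gt0 (x : algC) : (0 < degQ x)%N.
Proof. by rewrite /degQ -subn1 subn_gt0 size_minCpoly. Qed.

Lemma minQpoly_irreducible (x : algC) : irreducible_poly (minQpoly x).
Proof.
split=> [|q q_size1 q_dvd]; first by rewrite size_minQpoly ltnS degQ_gt0.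
have [c pE] := dvdpP _ _ q_dvd.
have q_neq0 : q != 0.
  by apply: contraNneq (minQpoly_neq0 x) => q0; rewrite pE q0 mulr0.
rewrite /eqp q_dvd /=; have := root_minQpoly x.
rewrite {1}pE rmorphM rootM !root_minQpoly_dvd => /orP[p_dvd_c|//].
have c_neq0 : c != 0.
  by apply: contraNneq (minQpoly_neq0 x) => c0; rewrite pE c0 mul0r.
have q_gt1 : (1 < size q)%N by rewrite ltn_neqAle eq_sym q_size1 size_poly_gt0.
have := dvdp_leq c_neq0 p_dvd_c; rewrite pE size_mul // leqNgt.
by rewrite -(subnKC q_gt1) addnS /= addnS ltnS leq_addr.
Qed.

Lemma conj_neq0 (x y : algC) :
  x != 0 -> root (pQtoC (minQpoly x)) y -> y != 0.
Proof.
move=> x_neq0 y_root.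
have : ~~ (minQpoly x %| 'X) by rewrite -root_minQpoly_dvd map_polyX rootX.
rewrite -irreducible_poly_coprime; last exact: minQpoly_irreducible.
rewrite -(coprimep_map (ratr : {rmorphism rat -> algC})) map_polyX.
by move/coprimep_root => /(_ _ y_root); rewrite hornerX.
Qed.

(** The roots are distinct because an irreducible polynomial cannot divide its derivative, which
    here is nonzero and of smaller degree. *)
Lemma conjugates_seq (x : algC) :
  exists r : seq algC,
    [/\ uniq r, size r = degQ x & all (root (pQtoC (minQpoly x))) r].
Proof.
have [r pE] := closed_field_poly_normal (pQtoC (minQpoly x)).
rewrite (monicP (monic_map _ (minQpoly_monic x))) scale1r in pE.
exists r; split.
- rewrite -separable_prod_XsubC -pE separable_map unlock.
  rewrite irreducible_poly_coprime; last exact: minQpoly_irreducible.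
  apply/negP => dv.
  have d_neq0 : (minQpoly x)^`() != 0.
    apply/eqP => /(congr1 (coefp (degQ x).-1))/eqP.
    rewrite /= coef_deriv coef0 prednK ?degQ_gt0 //.
    have /monicP := minQpoly_monic x; rewrite lead_coefE size_minQpoly /= => ->.
    by rewrite pnatr_eq0 eqn0Ngt degQ_gt0.
  have := dvdp_leq d_neq0 dv; rewrite leqNgt lt_size_deriv //.
  exact: minQpoly_neq0.
- have := congr1 (fun p : {poly algC} => size p) pE.
  by rewrite size_map_poly size_minQpoly size_prod_XsubC => -[].
by apply/allP => y; rewrite pE root_prod_XsubC.
Qed.

(** * Values of rational polynomials at algebraic numbers *)

Lemma horner_map_modp (x : algC) (p q : {poly rat}) :
  root (pQtoC p) x -> (pQtoC (q %% p)).[x] = (pQtoC q).[x].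
Proof.
move/rootP => px0; rewrite {2}(divp_eq q p) rmorphD rmorphM hornerD hornerM px0.
by rewrite mulr0 add0r.
Qed.

(* The matrix expresses the powers of [y] in the basis of powers of [x]; the
   degree condition makes it square and free, hence invertible. *)
Lemma same_degQ_primitive (x y : algC) (h : {poly rat}) :
    y = (pQtoC h).[x] -> degQ y = degQ x ->
  exists g : {poly rat}, x = (pQtoC g).[y].
Proof.
move=> yE deg_eq; set n := degQ x in deg_eq; set p := minQpoly x.
have size_modp_le q : (size (q %% p)%R <= n)%N.
  by rewrite -ltnS -size_minQpoly ltn_modp minQpoly_neq0.
pose M : 'M[rat]_n := \matrix_(i < n) poly_rV (h ^+ i %% p).
have evalM (u : 'rV_n) : (pQtoC (rVpoly (u *m M))).[x] = (pQtoC (rVpoly u)).[y].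
  rewrite mulmx_sum_row linear_sum rmorph_sum horner_sum /=.
  rewrite [RHS](@horner_coef_wide _ n); last by rewrite size_map_poly size_poly.
  apply: eq_bigr => i _; rewrite linearZ rowK /= poly_rV_K //.
  rewrite map_polyZ hornerZ horner_map_modp ?root_minQpoly // rmorphXn horner_exp.
  by rewrite coef_map coef_rVpoly_ord yE.
have M_unit : M \in unitmx.
  rewrite -row_free_unit; apply: inj_row_free => u uM0.
  have := evalM u; rewrite uM0 linear0 rmorph0 horner0 => /esym/rootP.
  rewrite root_minQpoly_dvd => dv; rewrite -[u]rVpolyK.
  suff -> : rVpoly u = 0 by rewrite linear0.
  apply/eqP/negPn/negP => u_neq0; have := dvdp_leq u_neq0 dv.
  by rewrite size_minQpoly deg_eq leqNgt ltnS size_poly.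
(* The coordinates of [x] in its own powers, carried over to the powers of [y]. Reducing ['X] modulo
   [p] matters only when [x] has degree 1. *)
exists (rVpoly (poly_rV ('X %% p) *m invmx M)).
rewrite -evalM mulmxKV // poly_rV_K // horner_map_modp ?root_minQpoly //.
by rewrite map_polyX hornerX.
Qed.

(* Reduce [P(x * eta)] modulo [q], as a polynomial in [eta] over [Q[x]]. *)
Lemma horner_mul_mod (q P : {poly rat}) :
  q != 0 ->
  exists C : nat -> {poly rat}, forall x eta : algC, root (pQtoC q) eta ->
    (pQtoC P).[x * eta] =
      \sum_(j < (size q).-1) (pQtoC (C j)).[x] * eta ^+ j.
Proof.
move=> q_neq0; set s := (size q).-1.
exists (fun j => \poly_(t < size P) (P`_t * ('X^t %% q)`_j)) => x eta eta_root.
rewrite (@horner_coef_wide _ (size P)) ?size_map_poly //.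
transitivity (\sum_(t < size P) \sum_(j < s)
   ratr (P`_t * ('X^t %% q)`_j) * x ^+ t * eta ^+ j : algC).
  apply: eq_bigr => t _; rewrite coef_map exprMn mulrA /=.
  have -> : eta ^+ t = (pQtoC ('X^t %% q)).[eta].
    by rewrite horner_map_modp // map_polyXn hornerXn.
  rewrite (@horner_coef_wide _ s); last first.
    by rewrite size_map_poly -ltnS prednK ?size_poly_gt0 // ltn_modp.
  rewrite mulr_sumr; apply: eq_bigr => j _.
  by rewrite coef_map rmorphM /=; ring.
rewrite exchange_big; apply: eq_bigr => j _.
rewrite (@horner_coef_wide _ (size P)); last first.
  by rewrite size_map_poly size_poly.
rewrite mulr_suml; apply: eq_bigr => t _.
by rewrite coef_map coef_poly ltn_ord.
Qed.

Lemma Qadjoin_horner (x : algC) (p : {poly rat}) : Qadjoin x (pQtoC p).[x].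
Proof. by exists p, 1; rewrite rmorph1 hornerC oner_neq0 divr1. Qed.

Lemma powers_lin_indep (x : algC) :
  lin_indep_over (fun y => y \in Crat) (fun i : 'I_(degQ x) => x ^+ i).
Proof.
move=> c cQ sum0 i.
have cE j : {a : rat | c j = ratr a}.
  by exists (getCrat (c j)); rewrite getCratK.
pose a j := sval (cE j).
(* [oapp] and [insub] extend [a] from ordinals to all naturals by the default value 0. *)
pose P : {poly rat} := \poly_(t < degQ x) oapp a 0 (insub t).
have Pcoef (j : 'I_(degQ x)) : P`_j = a j by rewrite coef_poly ltn_ord valK.
have : root (pQtoC P) x.
  apply/rootP; rewrite -[RHS]sum0 (@horner_coef_wide _ (degQ x)).
    by apply: eq_bigr => j _; rewrite coef_map Pcoef /a; case: (cE j) => b /= ->.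
  by rewrite size_map_poly size_poly.
rewrite root_minQpoly_dvd => dv; have [P0|P_neq0] := eqVneq P 0; last first.
  have := dvdp_leq P_neq0 dv; by rewrite size_minQpoly leqNgt ltnS size_poly.
move: (Pcoef i); rewrite P0 coef0 /a; case: (cE i) => b /= -> <-.
by rewrite rmorph0.
Qed.

(** * The factors of f_m(x^m) *)

Lemma prim_root_minQpoly (d : nat) (z : algC) : d.-primitive_root z ->
  degQ z = totient d /\
  forall x, root (pQtoC (minQpoly z)) x = d.-primitive_root x.
Proof.
move=> prim_z; rewrite /degQ map_minQpoly (minCpoly_cyclotomic prim_z).
by rewrite size_cyclotomic; split=> // x; rewrite root_cyclotomic.
Qed.

(** Expand [P] at [alpha * z] in the powers of [z] below its degree, with coefficients in Q(alpha).
    Linear disjointness kills each coefficient at [alpha], hence at every conjugate [x], and the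
    same coefficients compute [P] at [x * eta]. *)
Lemma root_conj_mul (alpha z : algC) (K : algC -> Prop) (P : {poly rat}) :
    lin_disjoint_overQ K (Qadjoin alpha) -> (forall i : nat, K (z ^+ i)) ->
    root (pQtoC P) (alpha * z) ->
  forall x eta : algC, root (pQtoC (minQpoly alpha)) x ->
    root (pQtoC (minQpoly z)) eta -> root (pQtoC P) (x * eta).
Proof.
move=> disj Kz /rootP Paz0 x eta x_root eta_root.
have [C CE] := horner_mul_mod P (minQpoly_neq0 z).
rewrite size_minQpoly /= in CE.
have C0 (j : 'I_(degQ z)) : (pQtoC (C j)).[alpha] = 0.
  apply: (disj _ _ (fun i : 'I_(degQ z) => Kz i) (@powers_lin_indep z)
            (fun j => (pQtoC (C j)).[alpha])).
    by move=> i; apply: Qadjoin_horner.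
  by rewrite -(CE alpha z (root_minQpoly z)).
apply/rootP; rewrite CE //; apply: big1 => j _.
suff /rootP -> : root (pQtoC (C j)) x by rewrite mul0r.
have /rootP := C0 j; rewrite root_minQpoly_dvd => /dvdpP[q ->].
by rewrite rmorphM rootM x_root orbT.
Qed.

(** The hypothesis is a rational polynomial equation in [alpha], so it passes to each conjugate [x],
    which is thus recovered from [x ^+ m]. *)
Lemma conj_pow_inj (alpha : algC) (m : nat) (g : {poly rat}) :
    alpha = (pQtoC g).[alpha ^+ m] ->
  {in root (pQtoC (minQpoly alpha)) &, injective (fun x => x ^+ m)}.
Proof.
move=> alphaE.
have conjE x : root (pQtoC (minQpoly alpha)) x -> x = (pQtoC g).[x ^+ m].
  have : minQpoly alpha %| 'X - (g \Po 'X^m).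
    rewrite -root_minQpoly_dvd /root rmorphB /= map_polyX map_comp_poly map_polyXn.
    by rewrite !hornerE horner_comp hornerXn -alphaE subrr.
  move=> /dvdpP[q qE] x_root; apply/eqP; rewrite -subr_eq0.
  have : root (pQtoC ('X - (g \Po 'X^m))) x by rewrite qE rmorphM rootM x_root orbT.
  rewrite /root rmorphB /= map_polyX map_comp_poly map_polyXn.
  by rewrite !hornerE horner_comp hornerXn.
by move=> x y x_root y_root /= eq_xy; rewrite (conjE x) // (conjE y) // eq_xy.
Qed.

Lemma degQ_mul_prim_root_ge (alpha z : algC) (m d : nat) (K : algC -> Prop) :
    alpha != 0 -> (0 < m)%N -> (d %| m)%N -> d.-primitive_root z ->
    lin_disjoint_overQ K (Qadjoin alpha) -> (forall i : nat, K (z ^+ i)) ->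
    degQ (alpha ^+ m) = degQ alpha ->
  (degQ alpha * totient d <= degQ (alpha * z)%R)%N.
Proof.
move=> alpha_neq0 m_gt0 d_dvd prim_z disj Kz deg_pow.
have [deg_z z_roots] := prim_root_minQpoly prim_z.
have [g gE] : exists g : {poly rat}, alpha = (pQtoC g).[alpha ^+ m].
  apply: (@same_degQ_primitive _ _ 'X^m) => //.
  by rewrite map_polyXn hornerXn.
have [r [r_uniq r_size /allP r_root]] := conjugates_seq alpha.
have [s [s_uniq s_size /allP s_root]] := conjugates_seq z.
pose rs := [seq x * eta | x <- r, eta <- s].
have eta_m eta : eta \in s -> eta ^+ m = 1.
  move/s_root; rewrite z_roots => /prim_expr_order eta1.
  by rewrite -(divnK d_dvd) mulnC exprM eta1 expr1n.
have rs_uniq : uniq rs.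
  apply: allpairs_uniq => // -[x eta] [y theta].
  move=> /allpairsP[[x' eta'] [/= x_r eta_s [-> ->]]].
  move=> /allpairsP[[y' theta'] [/= y_r theta_s [-> ->]]] /= eq_xy.
  (* The m-th power erases the roots of unity, and it is injective on the conjugates of [alpha]. *)
  have eq_x : x' = y'.
    apply: (conj_pow_inj gE); [exact: r_root | exact: r_root |].
    have := congr1 (fun t => t ^+ m) eq_xy.
    by rewrite /= !exprMn (eta_m eta') // (eta_m theta') // !mulr1.
  move: eq_xy; rewrite eq_x => /mulfI -> //.
  exact: conj_neq0 alpha_neq0 (r_root _ y_r).
have rs_root : all (root (pQtoC (minQpoly (alpha * z)))) rs.
  apply/allP => _ /allpairsP[[x eta] [/= x_r eta_s ->]].
  apply: (root_conj_mul disj Kz (root_minQpoly _)); first exact: r_root.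
  exact: s_root.
have nz : pQtoC (minQpoly (alpha * z)) != 0 by rewrite map_poly_eq0 minQpoly_neq0.
have := max_poly_roots nz rs_root rs_uniq.
by rewrite size_map_poly size_minQpoly ltnS size_allpairs r_size s_size deg_z.
Qed.

(* [alpha * z] satisfies [X^d = g(X^m)^d] when [alpha = g(alpha^m)]; at
   [alpha * w] this equation says [w^d = 1]. *)
Lemma minQpoly_mul_prim_root_order (alpha z w : algC) (m d e : nat) :
    alpha != 0 -> (d %| m)%N -> (e %| m)%N ->
    d.-primitive_root z -> e.-primitive_root w ->
    degQ (alpha ^+ m) = degQ alpha ->
  minQpoly (alpha * z) = minQpoly (alpha * w) -> (e %| d)%N.
Proof.
move=> alpha_neq0 d_dvd e_dvd prim_z prim_w deg_pow eq_min.
have [g gE] : exists g : {poly rat}, alpha = (pQtoC g).[alpha ^+ m].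
  apply: (@same_degQ_primitive _ _ 'X^m) => //.
  by rewrite map_polyXn hornerXn.
pose Q : {poly rat} := 'X^d - (g \Po 'X^m) ^+ d.
have pow_m c (y : algC) : (c %| m)%N -> c.-primitive_root y -> y ^+ m = 1.
  by move=> c_dvd /prim_expr_order yc; rewrite -(divnK c_dvd) mulnC exprM yc expr1n.
have QE (y : algC) : y ^+ m = 1 ->
    (pQtoC Q).[alpha * y] = alpha ^+ d * (y ^+ d - 1).
  move=> ym; rewrite rmorphB /= map_polyXn rmorphXn /= map_comp_poly map_polyXn.
  rewrite !hornerE horner_comp hornerXn !exprMn ym mulr1 -gE.
  by rewrite mulrBr mulr1.
have : root (pQtoC Q) (alpha * z).
  by apply/rootP; rewrite QE ?(pow_m d) // (prim_expr_order prim_z) subrr mulr0.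
rewrite root_minQpoly_dvd eq_min -root_minQpoly_dvd => /rootP.
rewrite QE ?(pow_m e) // => /eqP; rewrite mulf_eq0 expf_eq0 (negPf alpha_neq0) andbF.
by rewrite subr_eq0 (prim_order_dvd prim_w).
Qed.

(** * Products of irreducible factors and degree counting *)

Lemma prod_irreducible_dvd (F : fieldType) (I : eqType) (r : seq I)
    (P : I -> {poly F}) (q : {poly F}) :
    uniq r -> {in r, forall i, irreducible_poly (P i)} ->
    {in r &, forall i j, P i %= P j -> i = j} ->
    {in r, forall i, P i %| q} ->
  \prod_(i <- r) P i %| q.
Proof.
elim: r => [|i r IHr] /=; first by rewrite big_nil dvd1p.
case/andP=> i_r r_uniq irr inj dvd; rewrite big_cons Gauss_dvdp.
  have sub j : j \in r -> j \in i :: r by move=> jr; rewrite inE jr orbT.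
  rewrite dvd ?mem_head //=; apply: IHr => // [j /sub|j k /sub jr /sub kr|j /sub].
  - exact: irr.
  - exact: inj.
  - exact: dvd.
have irr_i := irr i (mem_head i r).
rewrite big_seq; elim/big_rec: _ => [|j p jr co_p]; first exact: coprimep1.
rewrite coprimepMr co_p andbT irreducible_poly_coprime //.
have jr' : j \in i :: r by rewrite inE jr orbT.
apply: contraNN i_r => dv; suff -> : i = j by [].
apply: inj => //; first exact: mem_head.
by apply: (irr j) => //; rewrite neq_ltn irr_i orbT.
Qed.

Lemma size_prod_monic (R : idomainType) (I : eqType) (r : seq I)
    (P : I -> {poly R}) :
    {in r, forall i, P i \is monic} ->
  (size (\prod_(i <- r) P i)).-1 = (\sum_(i <- r) (size (P i)).-1)%N.
Proof.
elim: r => [|i r IHr] P_mon; first by rewrite !big_nil size_poly1.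
have r_mon : {in r, forall j, P j \is monic}.
  by move=> j jr; rewrite P_mon // inE jr orbT.
have i_mon := P_mon i (mem_head i r).
have nz_r : \prod_(j <- r) P j != 0.
  by rewrite monic_neq0 // big_seq monic_prod.
rewrite !big_cons size_mul ?(monic_neq0 i_mon) // -IHr //.
move: nz_r (monic_neq0 i_mon); rewrite -!size_poly_gt0.
by case: (size _) (size _) => [|a] [|b] //=; rewrite addnS.
Qed.

(** Compare degrees in the factorization of X^m - 1 into cyclotomic polynomials. *)
Lemma sum_totient_divisors (m : nat) :
  (0 < m)%N -> (\sum_(d <- divisors m) totient d)%N = m.
Proof.
move=> m_gt0.
have := congr1 (fun p : {poly int} => (size p).-1) (prod_Cyclotomic m_gt0).
rewrite size_prod_monic => [|d _]; last exact: Cyclotomic_monic.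
rewrite size_XnsubC //= => sumE; rewrite -[RHS]sumE.
by apply: eq_bigr => d _; rewrite size_Cyclotomic.
Qed.

(** This turns the global degree count into an equality for each divisor: strict inequality at one
    term would make the sums strictly ordered. *)
Lemma leq_sum_seq_eq (I : eqType) (r : seq I) (E F : I -> nat) :
    {in r, forall i, (E i <= F i)%N} ->
    (\sum_(i <- r) F i <= \sum_(i <- r) E i)%N ->
  {in r, forall i, E i = F i}.
Proof.
move=> le_EF le_sum i ir; apply/eqP; rewrite eqn_leq le_EF //=.
move: le_sum; rewrite !(perm_big _ (perm_to_rem ir)) /= !big_cons => le_sum.
have le_rem : (\sum_(j <- rem i r) E j <= \sum_(j <- rem i r) F j)%N.
  rewrite big_seq [X in (_ <= X)%N]big_seq.
  by apply: leq_sum => j /mem_rem; apply: le_EF.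
by rewrite -(leq_add2r (\sum_(j <- rem i r) F j)%N) (leq_trans le_sum) ?leq_add2l.
Qed.

Theorem mainTheorem3 (alpha : algC) (k m : nat) (f fm : {poly rat})
  (alpha_int : alpha \in Aint) (alpha_neq0 : alpha != 0)
  (alpha_deg : degQ alpha = k) (f_min : is_minQpoly f alpha)
  (m_gt2 : (2 < m)%N)
  (disj : lin_disjoint_overQ (Qadjoin (zeta m)) (Qadjoin alpha))
  (deg_pow : degQ (alpha ^+ m) = degQ alpha)
  (fm_min : is_minQpoly fm (alpha ^+ m)) :
  exists Phi : nat -> {poly rat},
    [/\ fm \Po 'X^m = \prod_(d <- divisors m) Phi d,
        forall d : nat, (d %| m)%N ->
          [/\ irreducible_poly (Phi d),
              (size (Phi d)).-1 = ((size f).-1 * totient d)%N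
            & (size (Phi d)).-1 = (k * totient d)%N]
      & forall d e : nat, (d %| m)%N -> (e %| m)%N -> d <> e ->
          ~~ (Phi d %= Phi e)].
Proof.
have m_gt0 : (0 < m)%N by apply: leq_trans m_gt2.
have -> := is_minQpolyE f_min; have -> := is_minQpolyE fm_min.
pose z d := zeta m ^+ (m %/ d).
have prim_z d : (d %| m)%N -> d.-primitive_root (z d).
  by apply: dvdn_prim_root; apply: zeta_prim_root; apply: ltnW.
pose Phi d := minQpoly (alpha * z d).
have Phi_inj d e : (d %| m)%N -> (e %| m)%N -> Phi d %= Phi e -> d = e.
  move=> dm em; rewrite eqp_monic ?minQpoly_monic // => /eqP eq_Phi.
  apply/eqP; rewrite eqn_dvd.
  have [pd pe] := (prim_z d dm, prim_z e em).
  rewrite (minQpoly_mul_prim_root_order alpha_neq0 em dm pe pd deg_pow (esym eq_Phi)).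
  exact: (minQpoly_mul_prim_root_order alpha_neq0 dm em pd pe deg_pow eq_Phi).
have Fm_monic : minQpoly (alpha ^+ m) \Po 'X^m \is monic.
  rewrite monicE lead_coef_comp ?size_polyXn // lead_coefXn expr1n mulr1.
  by rewrite -monicE minQpoly_monic.
have prod_dvd : \prod_(d <- divisors m) Phi d %| minQpoly (alpha ^+ m) \Po 'X^m.
  apply: prod_irreducible_dvd; first exact: divisors_uniq.
  - by move=> d _; apply: minQpoly_irreducible.
  - by move=> d e; rewrite -!dvdn_divisors //; apply: Phi_inj.
  move=> d; rewrite -dvdn_divisors // => dm.
  (* Since [z d ^+ m = 1], the m-th power of [alpha * z d] is [alpha ^+ m]. *)
  rewrite -root_minQpoly_dvd map_comp_poly map_polyXn /root horner_comp hornerXn.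
  rewrite exprMn -[X in z d ^+ X](divnK dm) mulnC exprM.
  rewrite (prim_expr_order (prim_z d dm)) expr1n mulr1.
  exact: root_minQpoly.
have size_prod : (size (\prod_(d <- divisors m) Phi d)).-1 =
    (\sum_(d <- divisors m) degQ (alpha * z d)%R)%N.
  rewrite size_prod_monic => [|d _]; last exact: minQpoly_monic.
  by apply: eq_bigr => d _; rewrite size_minQpoly.
have size_Fm : (size (minQpoly (alpha ^+ m) \Po 'X^m)).-1 = (k * m)%N.
  by rewrite size_comp_poly size_polyXn size_minQpoly deg_pow alpha_deg.
have deg_ge : {in divisors m, forall d,
    (k * totient d <= degQ (alpha * z d)%R)%N}.
  move=> d; rewrite -dvdn_divisors // -alpha_deg => dm.
  apply: (degQ_mul_prim_root_ge alpha_neq0 m_gt0 dm (prim_z d dm) disj) => // i.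
  have -> : z d ^+ i = (pQtoC 'X^(m %/ d * i)).[zeta m].
    by rewrite map_polyXn hornerXn exprM.
  exact: Qadjoin_horner.
have sum_k : (\sum_(d <- divisors m) k * totient d)%N = (k * m)%N.
  by rewrite -big_distrr /= sum_totient_divisors.
have deg_eq : {in divisors m, forall d, (k * totient d)%N = degQ (alpha * z d)%R}.
  (* The lower bounds add up to the degree of f_m(x^m), which bounds the degree of its divisor, the
     product of the [Phi d]. *)
  apply: leq_sum_seq_eq => //; rewrite sum_k -size_prod -size_Fm -!subn1.
  by apply/leq_sub2r/dvdp_leq => //; apply: monic_neq0.
have prod_monic : \prod_(d <- divisors m) Phi d \is monic.
  by apply: monic_prod => d _; apply: minQpoly_monic.
exists Phi; split.
(* A monic divisor of a monic polynomial of the same degree is equal to it. *)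
- apply/esym/eqP; rewrite -eqp_monic // -dvdp_size_eqp //.
  rewrite -(prednK (n := size _)) ?size_poly_gt0 ?monic_neq0 //.
  rewrite -[X in _ == X]prednK ?size_poly_gt0 ?monic_neq0 //.
  by rewrite eqSS size_prod size_Fm -sum_k [X in _ == X]big_seq big_seq (eq_bigr _ deg_eq).
- move=> d dm; rewrite !size_minQpoly /= alpha_deg deg_eq -?dvdn_divisors //.
  by split=> //; apply: minQpoly_irreducible.
move=> d e dm em ne_de; apply/negP => /(Phi_inj d e dm em).
exact: ne_de.
Qed.
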